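(* Let $[a,b]$ be a finite segment, let $P,Q$ be complex-valued functions on $[a,b]$ with $Q$ non-vanishing on $[a,b]$, and let $\lambda\in\mathbb{C}$. Suppose that on $[a,b]$ the equation $$\left(\frac{1}{Q}v'\right)'+Pv=0$$ possesses a non-vanishing particular solution $v_0\in C^1[a,b]$ such that $\frac{v_0'}{Q}\in C^1[a,b]$ and the functions $v_0^2\frac{Q'}{Q^2}$, $\frac{v_0^2}{Q}$ and $\frac{Q}{v_0^2}$ are continuous on $[a,b]$. Let $x_0$ be an arbitrary point of $[a,b]$ and let the functions $\widetilde X^{(n)}$, $X^{(n)}$ be defined by the recursive integrals given in the context. Then the general solution on $[a,b]$ of the system $$v_1'=\lambda v_1+Pv_2,\qquad v_2'=-\lambda v_2-Qv_1$$ has the form $$v_1=-c_1\left(\frac{v_0'+\lambda v_0}{Q}\sum_{k=0}^{\infty}\lambda^k\widetilde X^{(2k)}+\frac{\lambda}{v_0}\sum_{k=0}^{\infty}\lambda^k\widetilde X^{(2k+1)}\right)-c_2\left(\frac{v_0'+\lambda v_0}{Q}\sum_{k=0}^{\infty}\lambda^kX^{(2k+1)}+\frac{1}{v_0}\sum_{k=0}^{\infty}\lambda^kX^{(2k)}\right),$$ $$v_2=c_1v_0\sum_{k=0}^{\infty}\lambda^k\widetilde X^{(2k)}+c_2v_0\sum_{k=0}^{\infty}\lambda^kX^{(2k+1)},$$ where $c_1$ and $c_2$ are arbitrary complex constants.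
   Context: The functions $\widetilde X^{(n)}$ and $X^{(n)}$ on $[a,b]$, $n\in\mathbb{Z}$, are defined by $\widetilde X^{(n)}\equiv X^{(n)}\equiv 0$ for $n<0$, $\widetilde X^{(0)}\equiv X^{(0)}\equiv 1$, and, for $n\ge 1$, $$\widetilde X^{(n)}(x)=\begin{cases}\displaystyle\int_{x_0}^{x}\left(\widetilde X^{(n-1)}(y)\,v_0^2(y)\frac{Q'(y)}{Q^2(y)}+\widetilde X^{(n-3)}(y)\frac{v_0^2(y)}{Q(y)}\right)dy, & n\text{ odd},\\[2mm] \displaystyle\int_{x_0}^{x}\widetilde X^{(n-1)}(y)\frac{Q(y)}{v_0^2(y)}\,dy, & n\text{ even},\end{cases}$$ $$X^{(n)}(x)=\begin{cases}\displaystyle\int_{x_0}^{x}X^{(n-1)}(y)\frac{Q(y)}{v_0^2(y)}\,dy, & n\text{ odd},\\[2mm] \displaystyle\int_{x_0}^{x}\left(X^{(n-1)}(y)\,v_0^2(y)\frac{Q'(y)}{Q^2(y)}+X^{(n-3)}(y)\frac{v_0^2(y)}{Q(y)}\right)dy, & n\text{ even}.\end{cases}$$ Here $Q$ is differentiable on $[a,b]$ with derivative $Q'$ (implicit in the hypotheses). Solutions are classical complex-valued solutions. ''General solution'' means that the set of all solution pairs $(v_1,v_2)$ is exactly the set of pairs of the displayed form with $c_1,c_2\in\mathbb{C}$, the pairs corresponding to $(c_1,c_2)=(1,0)$ and $(0,1)$ being linearly independent. The convention $\lambda^0=1$ is used also for $\lambda=0$. *)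

(* Defs.v *)
From Stdlib Require Export Reals.
From Coquelicot Require Export Coquelicot.

Open Scope C_scope.

Definition seg (a b x : R) : Prop := (a <= x <= b)%R.

(* Relative derivative of a complex-valued function of a real variable:
   on [a,b] it is one-sided at the endpoints, and the values of [f] outside
   [D] are irrelevant. *)
Definition is_deriv_on (D : R -> Prop) (f df : R -> C) : Prop :=
  forall x : R, D x ->
    filterdiff (K := R_AbsRing) (U := R_NormedModule) (V := C_R_NormedModule)
      f (within D (locally x)) (fun h : R => scal h (df x)).

Definition cont_on (D : R -> Prop) (f : R -> C) : Prop :=
  continuous_on (T := R_UniformSpace) (U := C_UniformSpace) D f.

Definition CInt (f : R -> C) (s t : R) : C :=
  RInt (V := C_R_CompleteNormedModule) f s t.

Definition Csummable (u : nat -> C) : Prop :=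
  ex_series (K := R_AbsRing) (V := C_R_NormedModule) u.

(* Meaningful only when [Csummable u], as [RInt] is only for integrable
   functions. *)
Definition CSeries (u : nat -> C) : C :=
  iota (T := C_R_CompleteNormedModule)
    (is_series (K := R_AbsRing) (V := C_R_NormedModule) u).

(* In the two families below [dQ] stands for Q'.  The term of index n - 3 is
   [prev3]; with n = S m it is the zero function for n < 3, in accordance with
   the convention that the functions of negative index vanish. *)
Fixpoint X_tilde (Q dQ v0 : R -> C) (x0 : R) (n : nat) {struct n} : R -> C :=
  match n with
  | O => fun _ => 1
  | S m =>
      let prev := X_tilde Q dQ v0 x0 m in
      let prev3 :=
        match m return R -> C with
        | S (S k) => X_tilde Q dQ v0 x0 k
        | _ => fun _ => 0
        end in
      if Nat.odd n then
        fun x => CInt (fun y => prev y * (v0 y ^ 2 * (dQ y / Q y ^ 2))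
                                + prev3 y * (v0 y ^ 2 / Q y)) x0 x
      else
        fun x => CInt (fun y => prev y * (Q y / v0 y ^ 2)) x0 x
  end.

Fixpoint X_plain (Q dQ v0 : R -> C) (x0 : R) (n : nat) {struct n} : R -> C :=
  match n with
  | O => fun _ => 1
  | S m =>
      let prev := X_plain Q dQ v0 x0 m in
      let prev3 :=
        match m return R -> C with
        | S (S k) => X_plain Q dQ v0 x0 k
        | _ => fun _ => 0
        end in
      if Nat.odd n then
        fun x => CInt (fun y => prev y * (Q y / v0 y ^ 2)) x0 x
      else
        fun x => CInt (fun y => prev y * (v0 y ^ 2 * (dQ y / Q y ^ 2))
                                + prev3 y * (v0 y ^ 2 / Q y)) x0 x
  end.

Definition system_solution (D : R -> Prop) (P Q : R -> C) (lam : C)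
    (v1 v2 : R -> C) : Prop :=
  is_deriv_on D v1 (fun x => lam * v1 x + P x * v2 x) /\
  is_deriv_on D v2 (fun x => - lam * v2 x - Q x * v1 x).

Definition gen_v1 (Q dQ v0 dv0 : R -> C) (x0 : R) (lam c1 c2 : C) (x : R) : C :=
  let Xt := fun n => X_tilde Q dQ v0 x0 n x in
  let X := fun n => X_plain Q dQ v0 x0 n x in
  - c1 * ((dv0 x + lam * v0 x) / Q x
            * CSeries (fun k => lam ^ k * Xt (2 * k)%nat)
          + lam / v0 x * CSeries (fun k => lam ^ k * Xt (2 * k + 1)%nat))
  - c2 * ((dv0 x + lam * v0 x) / Q x
            * CSeries (fun k => lam ^ k * X (2 * k + 1)%nat)
          + 1 / v0 x * CSeries (fun k => lam ^ k * X (2 * k)%nat)).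

Definition gen_v2 (Q dQ v0 : R -> C) (x0 : R) (lam c1 c2 : C) (x : R) : C :=
  let Xt := fun n => X_tilde Q dQ v0 x0 n x in
  let X := fun n => X_plain Q dQ v0 x0 n x in
  c1 * v0 x * CSeries (fun k => lam ^ k * Xt (2 * k)%nat)
  + c2 * v0 x * CSeries (fun k => lam ^ k * X (2 * k + 1)%nat).

(* Main.v *)
Require Import Defs.
From Stdlib Require Import Reals Lra Lia.
From Coquelicot Require Import Coquelicot.

Open Scope C_scope.

(** Write [r = Q / v0^2], [p = v0^2 Q' / Q^2], [q = v0^2 / Q].  The substitution
    [v2 = v0 g], [v1 = - ((v0' + lam v0) / Q) g - h / v0] is a bijection between
    pairs [(v1, v2)] and pairs [(g, h)], and, since [(v0' / Q)' = - P v0], it turns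
    the system into
      [g' = r h],  [h' = lam (p + lam q) g]
    ([system_iff_linear_pair]).  The coefficients [r], [p], [q] are continuous, and
    the four power series of the theorem are Picard series for this system: the
    pairs [(sum lam^k Xt(2k), lam sum lam^k Xt(2k+1))] and
    [(sum lam^k X(2k+1), sum lam^k X(2k))] solve it with initial values [(1, 0)] and
    [(0, 1)] at [x0].

    The two families of formal powers are treated at once, as sequences obeying
    [Y(n+1)(x) = int_{x0}^x (alpha_n Y(n) + beta_n Y(n-2))], where [alpha_n] and
    [beta_n] depend on the parity of [n] only.  For every [eps > 0] there is a [K]
    with [|Y(n)(x)| <= eps^n exp (K |x - x0|)], by induction on [n]: integrating the
    exponential gains the factor [1/K], which pays for the bounds of [alpha_n] and
    [beta_n] and for the missing powers of [eps] ([formal_powers_bound]).  With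
    [eps] small relative to [lam] the series are dominated by a geometric series
    together with their derivatives, so they may be differentiated termwise
    ([is_deriv_on_CSeries]).

    That every solution is a combination of these two needs no further estimate.
    The matrix of the system has trace zero, so the Wronskian of two solutions is
    constant; the Wronskian of the two basic solutions is [1], and Cramer's rule
    expresses any solution in them with constant coefficients
    ([linear_pair_general]).  Independence is read off at [x0]. *)

(** * Relative limits, continuity and derivatives of complex-valued functions *)

(** Continuity at [x] relative to [D], for the modulus on [C]; it is
    [filterlim f (within D (locally x)) (locally (f x))] ([cont_on_iff]). *)
Definition cts_at (D : R -> Prop) (f : R -> C) (x : R) : Prop :=
  forall eps : R, (0 < eps)%R -> exists del : R, (0 < del)%R /\
    forall y, D y -> (Rabs (y - x) < del)%R -> (Cmod (f y - f x) < eps)%R.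

Lemma norm_CR (z : C) : norm (K := R_AbsRing) (V := C_R_NormedModule) z = Cmod z.
Proof.
  change (sqrt ((Rabs (fst z))^2 + (Rabs (snd z))^2) = Cmod z)%R.
  unfold Cmod. now rewrite !pow2_abs.
Qed.

Lemma ball_Cmod (x y : C) (eps : posreal) :
  ball (M := C_UniformSpace) x eps y -> (Cmod (y - x) < sqrt 2 * eps)%R.
Proof. exact (C_NormedModule_mixin_compat2 x y eps). Qed.

Lemma Cmod_ball (x y : C) (eps : R) :
  (Cmod (y - x) < eps)%R -> ball (M := C_UniformSpace) x eps y.
Proof. exact (C_NormedModule_mixin_compat1 x y eps). Qed.

Lemma sqrt2_pos : (0 < sqrt 2)%R.
Proof. apply sqrt_lt_R0; lra. Qed.

Lemma filterlim_C_iff {T : Type} (F : (T -> Prop) -> Prop) (FF : Filter F) (f : T -> C) (l : C) :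
  filterlim f F (locally (T := C_UniformSpace) l) <->
  forall eps : R, (0 < eps)%R -> F (fun t => (Cmod (f t - l) < eps)%R).
Proof.
  pose proof sqrt2_pos as H2. split.
  - intros H eps He.
    assert (He2 : (0 < eps / sqrt 2)%R) by (apply Rdiv_lt_0_compat; lra).
    apply (proj1 (filterlim_locally (U := C_UniformSpace) _ _))
      with (eps := mkposreal _ He2) in H.
    revert H. apply filter_imp. intros t Ht.
    apply ball_Cmod in Ht. simpl in Ht.
    replace eps with (sqrt 2 * (eps / sqrt 2))%R by (field; lra). exact Ht.
  - intros H. apply (filterlim_locally (U := C_UniformSpace)). intros eps.
    generalize (H eps (cond_pos eps)). apply filter_imp. intros t Ht.
    now apply Cmod_ball.
Qed.

Lemma cont_on_iff D f : cont_on D f <-> forall x, D x -> cts_at D f x.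
Proof.
  split; intros H x Dx.
  - intros eps He.
    destruct (proj1 (filterlim_C_iff _ _ _ _) (H x Dx) eps He) as [d Hd].
    exists d. split; [apply cond_pos|]. intros y Dy Hy. exact (Hd y Hy Dy).
  - apply (filterlim_C_iff _ _). intros eps He.
    destruct (H x Dx eps He) as [d [d0 Hd]].
    exists (mkposreal d d0). intros y Hy Dy. exact (Hd y Dy Hy).
Qed.

(** The points to which the filter of the relative derivative at [x] converges
    reduce to [x], even where [x] is isolated in [D]. *)
Lemma within_lim_unique (D : R -> Prop) (x x' : R) : D x ->
  is_filter_lim (T := R_UniformSpace) (within D (locally x)) x' -> x' = x.
Proof.
  intros Dx H. destruct (Req_dec x' x) as [E|E]; [exact E|exfalso].
  assert (L : locally x' (fun z => z <> x)).
  { assert (d0 : (0 < Rabs (x' - x))%R) by (apply Rabs_pos_lt; lra).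
    exists (mkposreal _ d0). intros y Hy ->.
    change (Rabs (x - x') < Rabs (x' - x))%R in Hy.
    rewrite Rabs_minus_sym in Hy. lra. }
  destruct (H _ L) as [d Hd]. apply (Hd x); [apply ball_center|exact Dx|reflexivity].
Qed.

(** Caratheodory's form of the relative derivative: the slope of [f] at [x] extends
    to a function continuous at [x] with value [df x].  All rules of calculus below
    are reduced to the continuity of such slopes. *)
Lemma is_deriv_on_iff D f df : is_deriv_on D f df <->
  forall x, D x -> exists phi, cts_at D phi x /\ phi x = df x /\
    forall y, D y -> f y = f x + (y - x)%R * phi y.
Proof.
  split; intros H x Dx.
  - destruct (H x Dx) as [_ Hd].
    exists (fun y => if Req_EM_T y x then df x else (f y - f x) / (y - x)%R).
    assert (Hx : (if Req_EM_T x x then df x else (f x - f x) / (x - x)%R) = df x).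
    { destruct (Req_EM_T x x); [reflexivity|contradiction]. }
    split; [|split; [exact Hx|]].
    + intros eps He. rewrite Hx.
      assert (He2 : (0 < eps/2)%R) by lra.
      destruct (Hd x (fun P HP => filter_le_within _ _ HP) (mkposreal _ He2)) as [d Hdd].
      exists d. split; [apply cond_pos|].
      intros y Dy Hy.
      destruct (Req_EM_T y x) as [E|E].
      * unfold Cminus. rewrite Cplus_opp_r, Cmod_0. lra.
      * specialize (Hdd y Hy Dy). rewrite norm_CR in Hdd.
        change (Cmod ((f y - f x) - scal (V := C_R_NormedModule) (y - x)%R (df x))
                <= eps / 2 * Rabs (y - x))%R in Hdd.
        assert (E0 : RtoC (y - x)%R <> 0). { intro E0. apply RtoC_inj in E0. lra. }
        rewrite scal_R_Cmult in Hdd.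
        replace ((f y - f x) / (y - x)%R - df x)
          with (((f y - f x) - (y - x)%R * df x) / (y - x)%R) by (field; exact E0).
        rewrite Cmod_div by exact E0. rewrite Cmod_R.
        assert (0 < Rabs (y-x))%R by (apply Rabs_pos_lt; lra).
        apply Rle_lt_trans with (eps/2)%R; [|lra].
        apply Rle_div_l; [lra|]. exact Hdd.
    + intros y Dy. destruct (Req_EM_T y x) as [E|E].
      * subst y. replace (x-x)%R with 0%R by ring. ring.
      * field. intro E0. apply RtoC_inj in E0. lra.
  - destruct (H x Dx) as [phi [Hc [Hx Hf]]].
    split.
    { apply (is_linear_scal_l (K := R_AbsRing) (V := C_R_NormedModule)). }
    intros x' Hx' eps.
    rewrite (within_lim_unique D x x' Dx Hx').
    destruct (Hc eps (cond_pos eps)) as [d [d0 Hd]].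
    exists (mkposreal d d0). intros y Hy Dy. specialize (Hd y Dy Hy).
    rewrite norm_CR.
    change (Cmod ((f y - f x) - scal (V := C_R_NormedModule) (y - x)%R (df x))
            <= eps * Rabs (y - x))%R.
    rewrite scal_R_Cmult.
    rewrite (Hf y Dy), <- Hx.
    replace (f x + (y - x)%R * phi y - f x - (y - x)%R * phi x)
      with ((phi y - phi x) * (y - x)%R) by ring.
    rewrite Cmod_mult, Cmod_R. apply Rmult_le_compat_r; [apply Rabs_pos|lra].
Qed.

Lemma cts_at_const D c x : cts_at D (fun _ => c) x.
Proof.
  intros eps He. exists 1%R. split; [lra|]. intros y _ _.
  unfold Cminus. rewrite Cplus_opp_r, Cmod_0. exact He.
Qed.

Lemma cts_at_ext (D : R -> Prop) (f g : R -> C) x : D x -> (forall y, D y -> f y = g y) ->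
  cts_at D f x -> cts_at D g x.
Proof.
  intros Dx E H eps He. destruct (H eps He) as [d [d0 Hd]].
  exists d. split; [exact d0|]. intros y Dy Hy.
  rewrite <- (E y Dy), <- (E x Dx). now apply Hd.
Qed.

Lemma cts_at_plus D f g x : cts_at D f x -> cts_at D g x ->
  cts_at D (fun y => f y + g y) x.
Proof.
  intros Hf Hg eps He.
  destruct (Hf (eps / 2)%R ltac:(lra)) as [d [d0 Hd]].
  destruct (Hg (eps / 2)%R ltac:(lra)) as [d' [d'0 Hd']].
  exists (Rmin d d'). split; [now apply Rmin_glb_lt|]. intros y Dy Hy.
  specialize (Hd y Dy (Rlt_le_trans _ _ _ Hy (Rmin_l _ _))).
  specialize (Hd' y Dy (Rlt_le_trans _ _ _ Hy (Rmin_r _ _))).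
  replace (f y + g y - (f x + g x)) with ((f y - f x) + (g y - g x)) by ring.
  eapply Rle_lt_trans; [apply Cmod_triangle|lra].
Qed.

Lemma cts_at_mult D f g x : cts_at D f x -> cts_at D g x ->
  cts_at D (fun y => f y * g y) x.
Proof.
  intros Hf Hg eps He.
  pose proof (Cmod_ge_0 (f x)) as F0. pose proof (Cmod_ge_0 (g x)) as G0.
  set (A := (Cmod (f x) + 1)%R). set (B := (Cmod (g x) + 1)%R).
  assert (A1 : (0 < A)%R) by (unfold A; lra). assert (B1 : (0 < B)%R) by (unfold B; lra).
  destruct (Hf 1%R ltac:(lra)) as [d1 [d10 Hd1]].
  destruct (Hf (eps / (2 * B))%R) as [d2 [d20 Hd2]]; [apply Rdiv_lt_0_compat; lra|].
  destruct (Hg (eps / (2 * A))%R) as [d3 [d30 Hd3]]; [apply Rdiv_lt_0_compat; lra|].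
  exists (Rmin d1 (Rmin d2 d3)). split; [repeat apply Rmin_glb_lt; assumption|].
  intros y Dy Hy.
  apply Rmin_Rgt in Hy. destruct Hy as [Y1 Y2]. apply Rmin_Rgt in Y2. destruct Y2 as [Y2 Y3].
  specialize (Hd1 y Dy Y1). specialize (Hd2 y Dy Y2). specialize (Hd3 y Dy Y3).
  assert (FA : (Cmod (f y) <= A)%R).
  { replace (f y) with ((f y - f x) + f x) by ring.
    eapply Rle_trans; [apply Cmod_triangle|unfold A; lra]. }
  replace (f y * g y - f x * g x) with (f y * (g y - g x) + (f y - f x) * g x) by ring.
  eapply Rle_lt_trans; [apply Cmod_triangle|]. rewrite !Cmod_mult.
  assert (T1 : (Cmod (f y) * Cmod (g y - g x) < eps / 2)%R).
  { apply Rle_lt_trans with (A * Cmod (g y - g x))%R.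
    - apply Rmult_le_compat_r; [apply Cmod_ge_0|exact FA].
    - replace (eps / 2)%R with (A * (eps / (2 * A)))%R by (field; lra).
      now apply Rmult_lt_compat_l. }
  assert (T2 : (Cmod (f y - f x) * Cmod (g x) <= eps / 2)%R).
  { replace (eps / 2)%R with ((eps / (2 * B)) * B)%R by (field; lra).
    apply Rmult_le_compat; try apply Cmod_ge_0; [lra|unfold B; lra]. }
  lra.
Qed.

Lemma cts_at_inv (D : R -> Prop) (f : R -> C) x : (forall y, D y -> f y <> 0) -> D x ->
  cts_at D f x -> cts_at D (fun y => / f y) x.
Proof.
  intros Hn Dx Hf eps He.
  pose proof (proj1 (Cmod_gt_0 (f x)) (Hn x Dx)) as F0.
  set (A := Cmod (f x)) in *.
  destruct (Hf (A / 2)%R ltac:(lra)) as [d1 [d10 Hd1]].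
  destruct (Hf (eps * (A * A / 2))%R) as [d2 [d20 Hd2]].
  { apply Rmult_lt_0_compat; [lra|]. apply Rdiv_lt_0_compat; [|lra].
    now apply Rmult_lt_0_compat. }
  exists (Rmin d1 d2). split; [now apply Rmin_glb_lt|].
  intros y Dy Hy. apply Rmin_Rgt in Hy. destruct Hy as [Y1 Y2].
  specialize (Hd1 y Dy Y1). specialize (Hd2 y Dy Y2).
  assert (FA : (A / 2 <= Cmod (f y))%R).
  { assert (T : (A <= Cmod (f y) + Cmod (f y - f x))%R); [|lra].
    unfold A. replace (f x) with (f y + - (f y - f x)) at 1 by ring.
    eapply Rle_trans; [apply Cmod_triangle|]. rewrite Cmod_opp. lra. }
  replace (/ f y - / f x) with (- (f y - f x) / (f y * f x))
    by (field; split; [exact (Hn x Dx)|exact (Hn y Dy)]).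
  rewrite Cmod_div by (apply Cmult_neq_0; [exact (Hn y Dy)|exact (Hn x Dx)]).
  rewrite Cmod_opp, Cmod_mult. fold A.
  apply Rlt_div_l; [apply Rmult_lt_0_compat; lra|].
  eapply Rlt_le_trans; [exact Hd2|]. apply Rmult_le_compat_l; [lra|].
  replace (A * A / 2)%R with (A / 2 * A)%R by field.
  apply Rmult_le_compat_r; lra.
Qed.

Lemma cont_on_const D c : cont_on D (fun _ => c).
Proof. apply cont_on_iff. intros x _. apply cts_at_const. Qed.

Lemma cont_on_plus D f g : cont_on D f -> cont_on D g -> cont_on D (fun y => f y + g y).
Proof.
  rewrite !cont_on_iff. intros Hf Hg x Dx. apply cts_at_plus; auto.
Qed.

Lemma cont_on_mult D f g : cont_on D f -> cont_on D g -> cont_on D (fun y => f y * g y).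
Proof.
  rewrite !cont_on_iff. intros Hf Hg x Dx. apply cts_at_mult; auto.
Qed.

Lemma cts_at_id D x : cts_at D (fun y => RtoC y) x.
Proof.
  intros eps He. exists eps. split; [exact He|]. intros y _ Hy.
  rewrite <- RtoC_minus, Cmod_R. exact Hy.
Qed.

Lemma is_deriv_on_cont D f df : is_deriv_on D f df -> cont_on D f.
Proof.
  rewrite is_deriv_on_iff, cont_on_iff. intros H x Dx.
  destruct (H x Dx) as [phi [Hc [Hx Hf]]].
  apply cts_at_ext with (f := fun y => f x + (RtoC y + - RtoC x) * phi y); [exact Dx| |].
  - intros y Dy. rewrite (Hf y Dy), RtoC_minus. reflexivity.
  - apply cts_at_plus; [apply cts_at_const|]. apply cts_at_mult; [|exact Hc].
    apply cts_at_plus; [apply cts_at_id|apply cts_at_const].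
Qed.

Lemma is_deriv_on_ext (D : R -> Prop) (f g df dg : R -> C) :
  (forall x, D x -> f x = g x) -> (forall x, D x -> df x = dg x) ->
  is_deriv_on D f df -> is_deriv_on D g dg.
Proof.
  rewrite !is_deriv_on_iff. intros E dE H x Dx.
  destruct (H x Dx) as [phi [Hc [Hx Hf]]]. exists phi. split; [exact Hc|split].
  - rewrite Hx. auto.
  - intros y Dy. rewrite <- !E by assumption. auto.
Qed.

Lemma is_deriv_on_const D c : is_deriv_on D (fun _ => c) (fun _ => 0).
Proof.
  apply is_deriv_on_iff. intros x _. exists (fun _ => 0).
  split; [apply cts_at_const|split; [reflexivity|]]. intros y _. ring.
Qed.

Lemma is_deriv_on_plus D f g df dg : is_deriv_on D f df -> is_deriv_on D g dg ->
  is_deriv_on D (fun x => f x + g x) (fun x => df x + dg x).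
Proof.
  rewrite !is_deriv_on_iff. intros Hf Hg x Dx.
  destruct (Hf x Dx) as [phi [Pc [Px Pf]]]. destruct (Hg x Dx) as [psi [Sc [Sx Sf]]].
  exists (fun y => phi y + psi y). split; [now apply cts_at_plus|split].
  - now rewrite Px, Sx.
  - intros y Dy. rewrite (Pf y Dy), (Sf y Dy). ring.
Qed.

Lemma is_deriv_on_mult D f g df dg : is_deriv_on D f df -> is_deriv_on D g dg ->
  is_deriv_on D (fun x => f x * g x) (fun x => df x * g x + f x * dg x).
Proof.
  intros Hf Hg. pose proof (is_deriv_on_cont _ _ _ Hf) as Cf.
  revert Hf Hg Cf. rewrite !is_deriv_on_iff, cont_on_iff. intros Hf Hg Cf x Dx.
  destruct (Hf x Dx) as [phi [Pc [Px Pf]]]. destruct (Hg x Dx) as [psi [Sc [Sx Sf]]].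
  exists (fun y => phi y * g x + f y * psi y). split; [|split].
  - apply cts_at_plus; apply cts_at_mult; auto. apply cts_at_const.
  - now rewrite Px, Sx.
  - intros y Dy. rewrite (Sf y Dy). rewrite (Pf y Dy) at 1. ring_simplify.
    rewrite (Pf y Dy). ring.
Qed.

Lemma is_deriv_on_inv (D : R -> Prop) (f df : R -> C) : (forall x, D x -> f x <> 0) ->
  is_deriv_on D f df -> is_deriv_on D (fun x => / f x) (fun x => - df x / (f x * f x)).
Proof.
  intros Hn Hf. pose proof (is_deriv_on_cont _ _ _ Hf) as Cf.
  revert Hf Cf. rewrite !is_deriv_on_iff, cont_on_iff. intros Hf Cf x Dx.
  destruct (Hf x Dx) as [phi [Pc [Px Pf]]].
  exists (fun y => (- (1) * phi y) * (/ f y * / f x)). split; [|split].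
  - repeat apply cts_at_mult; auto using cts_at_const. apply cts_at_inv; auto.
  - rewrite Px. field. auto.
  - intros y Dy.
    assert (E : (y - x)%R * phi y = f y - f x) by (rewrite (Pf y Dy); ring).
    replace ((y - x)%R * (- (1) * phi y * (/ f y * / f x)))
      with (- ((y - x)%R * phi y) * (/ f y * / f x)) by ring.
    rewrite E. field. auto.
Qed.

Lemma is_deriv_on_scal D c f df : is_deriv_on D f df ->
  is_deriv_on D (fun x => c * f x) (fun x => c * df x).
Proof.
  intros H. apply is_deriv_on_ext with (f := fun x => c * f x) (df := fun x => 0 * f x + c * df x).
  - reflexivity.
  - intros; ring.
  - apply is_deriv_on_mult; [apply is_deriv_on_const|exact H].
Qed.

(** The retraction of the line onto [[a, b]].  Composing with it turns relative
    continuity on the segment into continuity on the line, as integrability and the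
    fundamental theorem require. *)
Definition clamp (a b x : R) : R := Rmax a (Rmin b x).

Lemma clamp_seg a b x : (a <= b)%R -> seg a b (clamp a b x).
Proof.
  intros H. unfold seg, clamp. split; [apply Rmax_l|].
  apply Rmax_lub; [exact H|apply Rmin_l].
Qed.

Lemma clamp_id a b x : seg a b x -> clamp a b x = x.
Proof.
  intros [H1 H2]. unfold clamp. rewrite Rmin_right, Rmax_right; lra.
Qed.

Lemma clamp_lip a b x y : (Rabs (clamp a b y - clamp a b x) <= Rabs (y - x))%R.
Proof.
  unfold clamp, Rmax, Rmin, Rabs.
  repeat destruct Rle_dec; repeat destruct Rcase_abs; lra.
Qed.

Lemma seg_between a b s t x : seg a b s -> seg a b t ->
  (Rmin s t <= x <= Rmax s t)%R -> seg a b x.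
Proof.
  unfold seg, Rmin, Rmax. repeat destruct Rle_dec; lra.
Qed.

Lemma continuous_clamp a b f x : (a <= b)%R -> cont_on (seg a b) f ->
  continuous (T := R_UniformSpace) (U := C_UniformSpace) (fun t => f (clamp a b t)) x.
Proof.
  intros Hab Hf. rewrite cont_on_iff in Hf.
  apply (filterlim_C_iff _ _). intros eps He.
  destruct (Hf _ (clamp_seg a b x Hab) eps He) as [d [d0 Hd]].
  exists (mkposreal d d0). intros y Hy. apply Hd; [now apply clamp_seg|].
  eapply Rle_lt_trans; [apply clamp_lip|exact Hy].
Qed.

Lemma ex_CInt a b f s t : cont_on (seg a b) f -> seg a b s -> seg a b t ->
  ex_RInt (V := C_R_NormedModule) f s t.
Proof.
  intros Hf Hs Ht.
  apply (ex_RInt_ext (V := C_R_NormedModule) (fun t => f (clamp a b t))).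
  - intros x Hx. rewrite clamp_id; [reflexivity|].
    apply (seg_between a b s t); auto. lra.
  - apply (ex_RInt_continuous (V := C_R_CompleteNormedModule)).
    intros z _. apply continuous_clamp; [unfold seg in Hs; lra|exact Hf].
Qed.

Lemma CInt_ext_seg a b (f g : R -> C) s t : seg a b s -> seg a b t ->
  (forall x, seg a b x -> f x = g x) -> CInt f s t = CInt g s t.
Proof.
  intros Hs Ht E. apply (RInt_ext (V := C_R_CompleteNormedModule)).
  intros x Hx. apply E. apply (seg_between a b s t); auto. lra.
Qed.

(** The fundamental theorem of calculus, one-sided at the endpoints. *)
Lemma is_deriv_on_CInt a b f x0 : cont_on (seg a b) f -> seg a b x0 ->
  is_deriv_on (seg a b) (fun x => CInt f x0 x) f.
Proof.
  intros Hf H0. assert (Hab : (a <= b)%R) by (unfold seg in H0; lra).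
  apply is_deriv_on_ext with (f := fun x => CInt (fun t => f (clamp a b t)) x0 x)
    (df := fun x => f (clamp a b x)).
  - intros x Hx. apply (CInt_ext_seg a b); auto.
    intros y Hy. now rewrite clamp_id.
  - intros x Hx. now rewrite clamp_id.
  - intros x Hx.
    assert (L : is_derive (V := C_R_NormedModule) (fun x => CInt (fun t => f (clamp a b t)) x0 x)
              x (f (clamp a b x))).
    { apply (is_derive_RInt (V := C_R_NormedModule) (fun t => f (clamp a b t)) _ x0).
      - exists (mkposreal 1 Rlt_0_1). intros y _.
        apply (RInt_correct (V := C_R_CompleteNormedModule)).
        apply (ex_RInt_continuous (V := C_R_CompleteNormedModule)).
        intros z _. now apply continuous_clamp.
      - now apply continuous_clamp. }
    destruct L as [L1 L2]. split; [exact L1|].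
    intros x' Hx' eps. rewrite (within_lim_unique _ x x' Hx Hx').
    apply filter_le_within. apply L2. intros P HP; exact HP.
Qed.

(** Where [f' = 0] relative to the segment, the composition of [f] with the
    retraction has derivative zero in the two-sided sense, at the endpoints too. *)
Lemma is_deriv_on_zero_const a b (f : R -> C) x y : is_deriv_on (seg a b) f (fun _ => 0) ->
  seg a b x -> seg a b y -> f x = f y.
Proof.
  intros H.
  assert (L : forall x y, seg a b x -> seg a b y -> (x < y)%R -> f x = f y).
  { clear x y. intros x y Hx Hy Hxy.
    assert (Hab : (a <= b)%R) by (unfold seg in *; lra).
    rewrite <- (clamp_id a b x Hx), <- (clamp_id a b y Hy).
    apply (eq_is_derive (V := C_R_NormedModule) (fun t => f (clamp a b t)) x y); [|exact Hxy].
    intros t Ht. assert (St : seg a b t) by (unfold seg in *; lra).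
    rewrite is_deriv_on_iff in H. destruct (H t St) as [phi [Hc [Ht0 Hf]]].
    split; [apply (is_linear_scal_l (K := R_AbsRing) (V := C_R_NormedModule))|].
    intros t' Ht' eps.
    rewrite <- (is_filter_lim_locally_unique (K := R_AbsRing) (V := R_NormedModule) t t' Ht').
    destruct (Hc eps (cond_pos eps)) as [d [d0 Hd]].
    exists (mkposreal d d0). intros z Hz.
    change (Rabs (z - t) < d)%R in Hz.
    rewrite norm_CR.
    change (Cmod ((f (clamp a b z) - f (clamp a b t))
       - scal (V:=C_R_NormedModule) (z - t)%R (RtoC 0)) <= eps * Rabs (z - t))%R.
    rewrite scal_R_Cmult, (clamp_id a b t St).
    pose proof (clamp_lip a b t z) as CL. rewrite (clamp_id a b t St) in CL.
    specialize (Hd _ (clamp_seg a b z Hab) (Rle_lt_trans _ _ _ CL Hz)).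
    rewrite (Hf _ (clamp_seg a b z Hab)).
    replace (f t + (clamp a b z - t)%R * phi (clamp a b z) - f t - (z - t)%R * 0)
      with ((phi (clamp a b z) - phi t) * (clamp a b z - t)%R) by (rewrite Ht0; ring).
    rewrite Cmod_mult, Cmod_R.
    apply Rmult_le_compat; try apply Cmod_ge_0; try apply Rabs_pos; lra. }
  intros Hx Hy. destruct (Rtotal_order x y) as [T|[T|T]].
  - auto. - now subst. - symmetry. auto.
Qed.

Lemma CInt_deriv a b (f df : R -> C) x y : is_deriv_on (seg a b) f df -> cont_on (seg a b) df ->
  seg a b x -> seg a b y -> f y - f x = CInt df x y.
Proof.
  intros Hf Hc Hx Hy.
  assert (E : f y + - (1) * CInt df x y = f x + - (1) * CInt df x x).
  { apply (is_deriv_on_zero_const a b (fun t => f t + - (1) * CInt df x t)); auto.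
    apply is_deriv_on_ext with (f := fun t => f t + - (1) * CInt df x t)
      (df := fun t => df t + - (1) * df t); [reflexivity|intros; ring|].
    apply is_deriv_on_plus; [exact Hf|]. apply is_deriv_on_scal. now apply is_deriv_on_CInt. }
  unfold CInt in E at 2. rewrite RInt_point in E.
  change (zero (G := C_R_CompleteNormedModule)) with (RtoC 0) in E.
  replace (f y) with ((f y + - (1) * CInt df x y) + CInt df x y) by ring.
  rewrite E. ring.
Qed.

(** The mean value inequality. *)
Lemma Cmod_deriv_le a b (f df : R -> C) B x y :
  is_deriv_on (seg a b) f df -> cont_on (seg a b) df ->
  (forall t, seg a b t -> (Cmod (df t) <= B)%R) ->
  seg a b x -> seg a b y -> (Cmod (f y - f x) <= Rabs (y - x) * B)%R.
Proof.
  intros Hf Hc HB.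
  assert (L : forall x y, seg a b x -> seg a b y -> (x <= y)%R ->
            (Cmod (f y - f x) <= Rabs (y - x) * B)%R).
  { clear x y. intros x y Hx Hy Hxy. rewrite (CInt_deriv a b f df) by assumption.
    rewrite Rabs_right by lra. rewrite <- norm_CR.
    apply (norm_RInt_le_const (V := C_R_NormedModule) df x y _ B Hxy).
    - intros t Ht. rewrite norm_CR. apply HB. unfold seg in *; lra.
    - apply (RInt_correct (V := C_R_CompleteNormedModule)). now apply (ex_CInt a b). }
  intros Hx Hy. destruct (Rle_dec x y) as [T|T]; [now apply L|].
  replace (f y - f x) with (- (f x - f y)) by ring.
  rewrite Cmod_opp, Rabs_minus_sym. apply L; auto. lra.
Qed.

Lemma cont_on_bounded a b (f : R -> C) : (a <= b)%R -> cont_on (seg a b) f ->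
  exists M : R, forall x, seg a b x -> (Cmod (f x) <= M)%R.
Proof.
  intros Hab Hf.
  destruct (bounded_continuity (V := C_R_NormedModule) (fun t => f (clamp a b t)) a b) as [M HM].
  - intros x _. now apply continuous_clamp.
  - exists M. intros x Hx. specialize (HM x Hx). rewrite norm_CR, clamp_id in HM by exact Hx. lra.
Qed.

(** Integration against the weight [exp (K |t - x0|)] gains a factor [1 / K]. *)
Lemma Cmod_CInt_exp_le a b (f : R -> C) A K x0 x : cont_on (seg a b) f -> (0 < K)%R -> (0 <= A)%R ->
  seg a b x0 -> seg a b x ->
  (forall t, seg a b t -> (Cmod (f t) <= A * exp (K * Rabs (t - x0)))%R) ->
  (Cmod (CInt f x0 x) <= A / K * exp (K * Rabs (x - x0)))%R.
Proof.
  intros Hf HK HA H0 Hx HB.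
  assert (AK : (0 <= A / K)%R) by (apply Rdiv_le_0_compat; lra).
  destruct (Rle_dec x0 x) as [T|T].
  - rewrite <- norm_CR.
    apply Rle_trans with (A / K * exp (K * (x - x0)) - A / K * exp (K * (x0 - x0)))%R.
    + apply (norm_RInt_le (V := C_R_NormedModule) f (fun t => A * exp (K * (t - x0)))%R x0 x); auto.
      * intros t Ht. rewrite norm_CR. rewrite <- (Rabs_right (t - x0)) by lra.
        apply HB. unfold seg in *; lra.
      * apply (RInt_correct (V := C_R_CompleteNormedModule)). now apply (ex_CInt a b).
      * apply (is_RInt_derive (fun t => A / K * exp (K * (t - x0)))%R).
        -- intros t _. auto_derive; [trivial|]. unfold Rminus. field. lra.
        -- intros t _. apply (ex_derive_continuous (K := R_AbsRing) (V := R_NormedModule)).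
           auto_derive. trivial.
    + rewrite Rabs_right by lra. pose proof (exp_pos (K * (x0 - x0))). nra.
  - apply Rle_trans with ((- (A / K) * exp (K * (x0 - x0))) - - (A / K) * exp (K * (x0 - x)))%R.
    + replace (CInt f x0 x) with (- CInt f x x0)
        by exact (opp_RInt_swap (V := C_R_CompleteNormedModule) f x x0
                    (ex_CInt a b f x x0 Hf Hx H0)).
      rewrite Cmod_opp, <- norm_CR.
      apply (norm_RInt_le (V := C_R_NormedModule) f (fun t => A * exp (K * (x0 - t)))%R x x0);
        [lra| | |].
      * intros t Ht. rewrite norm_CR. replace (x0 - t)%R with (Rabs (t - x0))
          by (rewrite Rabs_left1; lra).
        apply HB. unfold seg in *; lra.
      * apply (RInt_correct (V := C_R_CompleteNormedModule)). now apply (ex_CInt a b).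
      * apply (is_RInt_derive (fun t => - (A / K) * exp (K * (x0 - t)))%R).
        -- intros t _. auto_derive; [trivial|]. unfold Rminus. field. lra.
        -- intros t _. apply (ex_derive_continuous (K := R_AbsRing) (V := R_NormedModule)).
           auto_derive. trivial.
    + rewrite Rabs_left1 by lra. replace (- (x - x0))%R with (x0 - x)%R by ring.
      pose proof (exp_pos (K * (x0 - x0))). nra.
Qed.

(** * Series of complex numbers and functions dominated by a geometric series *)

(** The series of [u] converges to [l]. *)
Definition is_Cseries (u : nat -> C) (l : C) : Prop :=
  is_series (K := R_AbsRing) (V := C_R_NormedModule) u l.

(** Domination by the geometric series of ratio [1/2]. *)
Definition geom_bounded (A : R) (u : nat -> C) : Prop :=
  forall k, (Cmod (u k) <= A * (1 / 2) ^ k)%R.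

Lemma is_Cseries_CSeries u l : is_Cseries u l -> CSeries u = l.
Proof.
  apply (iota_filterlim_locally (V := C_R_CompleteNormedModule)).
Qed.

Lemma Csummable_geom A u : geom_bounded A u -> Csummable u.
Proof.
  intros H. apply (ex_series_le (V := C_R_CompleteNormedModule) u (fun k => A * (1 / 2) ^ k)%R).
  - intros k. rewrite norm_CR. apply H.
  - apply (ex_series_scal (K := R_AbsRing) (V := R_NormedModule) A).
    apply ex_series_geom. rewrite Rabs_right; lra.
Qed.

Lemma CSeries_geom A u : geom_bounded A u -> is_Cseries u (CSeries u).
Proof.
  intros H. destruct (Csummable_geom A u H) as [l Hl].
  rewrite (is_Cseries_CSeries u l Hl). exact Hl.
Qed.

Lemma is_Cseries_plus u v l m : is_Cseries u l -> is_Cseries v m ->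
  is_Cseries (fun k => u k + v k) (l + m).
Proof. apply (is_series_plus (V := C_R_NormedModule)). Qed.

Lemma sum_n_Cmult c (u : nat -> C) n :
  sum_n (G := C_R_NormedModule) (fun k => c * u k) n = c * sum_n (G := C_R_NormedModule) u n.
Proof.
  induction n as [|n IH].
  - now rewrite !sum_O.
  - rewrite !sum_Sn, IH. symmetry. exact (Cmult_plus_distr_l _ _ _).
Qed.

Lemma is_Cseries_scal c u l : is_Cseries u l -> is_Cseries (fun k => c * u k) (c * l).
Proof.
  intros H. apply (filterlim_C_iff _ _). intros eps He.
  assert (P : (0 < Cmod c + 1)%R) by (pose proof (Cmod_ge_0 c); lra).
  generalize (proj1 (filterlim_C_iff _ _ _ _) H (eps / (Cmod c + 1))%R
    (Rdiv_lt_0_compat _ _ He P)).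
  apply filter_imp. intros n Hn.
  rewrite sum_n_Cmult.
  match goal with |- (Cmod (c * ?z - c * l) < eps)%R =>
    replace (c * z - c * l) with (c * (z - l)) by ring end.
  rewrite Cmod_mult.
  apply Rlt_div_r in Hn; [|lra].
  match goal with |- (_ * ?z < _)%R =>
    pose proof (Cmod_ge_0 c); assert (0 <= z)%R by apply Cmod_ge_0 end.
  nra.
Qed.

(** Adding the initial term to a series indexed from [1]. *)
Lemma is_Cseries_shift u l : is_Cseries (fun k => u (S k)) l -> is_Cseries u (u O + l).
Proof.
  intros H. apply (is_series_decr_1 (V := C_R_NormedModule)).
  change (is_Cseries (fun k => u (S k)) (u O + l + - u O)).
  replace (u O + l + - u O) with l by ring. exact H.
Qed.

Lemma is_Cseries_ext u v l : (forall k, u k = v k) -> is_Cseries u l -> is_Cseries v l.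
Proof. apply (is_series_ext (V := C_R_NormedModule)). Qed.

Lemma CSeries_ext u v : (forall k, u k = v k) -> Csummable u -> CSeries u = CSeries v.
Proof.
  intros E [l Hl]. rewrite (is_Cseries_CSeries u l Hl). symmetry.
  apply is_Cseries_CSeries. now apply (is_Cseries_ext u).
Qed.

Lemma geom_bounded_shift A u : geom_bounded A u -> geom_bounded (A / 2) (fun k => u (S k)).
Proof.
  intros H k. replace (A / 2 * (1 / 2) ^ k)%R with (A * (1 / 2) ^ S k)%R by (simpl; field).
  apply H.
Qed.

Lemma CSeries_split A u : geom_bounded A u ->
  CSeries u = u O + CSeries (fun k => u (S k)).
Proof.
  intros H. apply is_Cseries_CSeries. apply is_Cseries_shift.
  apply (CSeries_geom (A / 2)). now apply geom_bounded_shift.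
Qed.

Lemma Cmod_CSeries_le A u : geom_bounded A u -> (Cmod (CSeries u) <= 2 * A)%R.
Proof.
  intros H. pose proof (CSeries_geom A u H) as HS.
  assert (A0 : (0 <= A)%R).
  { specialize (H O). simpl in H. pose proof (Cmod_ge_0 (u O)). lra. }
  assert (B : forall n, (Cmod (sum_n (G := C_R_NormedModule) u n) <= A * (2 - (1 / 2) ^ n))%R).
  { induction n as [|n IH].
    - rewrite sum_O. specialize (H O). simpl in *. lra.
    - rewrite sum_Sn. change plus with Cplus.
      eapply Rle_trans; [apply Cmod_triangle|]. specialize (H (S n)). simpl in *. lra. }
  apply Rnot_lt_le. intros L.
  destruct (proj1 (filterlim_C_iff _ _ _ _) HS (Cmod (CSeries u) - 2 * A)%R ltac:(lra)) as [N HN].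
  specialize (HN N (le_n N)). specialize (B N).
  pose proof (pow_le (1 / 2) N ltac:(lra)) as P.
  assert (T : (Cmod (CSeries u) <= Cmod (sum_n (G := C_R_NormedModule) u N)
    + Cmod (sum_n (G := C_R_NormedModule) u N - CSeries u))%R).
  { replace (CSeries u) with (sum_n (G := C_R_NormedModule) u N
      + - (sum_n (G := C_R_NormedModule) u N - CSeries u)) at 1.
    2:{ match goal with |- ?x + - (?x - ?y) = _ => ring_simplify (x + - (x - y)) end; reflexivity. }
    eapply Rle_trans; [apply Cmod_triangle|]. rewrite Cmod_opp. apply Rle_refl. }
  nra.
Qed.

(** Continuity of the sum of a uniformly dominated series.  Splitting off one term
    halves the constant [A], so the oscillation of the sum near [x] is below
    [eps + 4 A / 2^N] for each [N], by induction on [N]. *)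
Lemma cts_at_CSeries D (u : nat -> R -> C) A x : D x ->
  (forall k, cts_at D (u k) x) -> (forall y, D y -> geom_bounded A (fun k => u k y)) ->
  cts_at D (fun y => CSeries (fun k => u k y)) x.
Proof.
  intros Dx Hc Hb.
  assert (A0 : (0 <= A)%R).
  { specialize (Hb x Dx O). simpl in Hb. pose proof (Cmod_ge_0 (u O x)). lra. }
  assert (L : forall N u A, (forall k, cts_at D (u k) x) ->
    (forall y, D y -> geom_bounded A (fun k => u k y)) ->
    forall eps : R, (0 < eps)%R -> exists del : R, (0 < del)%R /\
      forall y, D y -> (Rabs (y - x) < del)%R ->
      (Cmod (CSeries (fun k => u k y) - CSeries (fun k => u k x)) < eps + 4 * A * (1 / 2) ^ N)%R).
  { clear u A Hc Hb A0. induction N as [|N IH]; intros u A Hc Hb eps He.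
    - exists 1%R. split; [lra|]. intros y Dy _.
      eapply Rle_lt_trans; [apply Cmod_triangle|]. rewrite Cmod_opp.
      pose proof (Cmod_CSeries_le A _ (Hb y Dy)). pose proof (Cmod_CSeries_le A _ (Hb x Dx)).
      simpl. lra.
    - destruct (Hc O (eps / 2)%R ltac:(lra)) as [d [d0 Hd]].
      destruct (IH (fun k => u (S k)) (A / 2)%R) with (eps := (eps / 2)%R) as [d' [d'0 Hd']].
      + intros k. apply Hc.
      + intros y Dy. apply (geom_bounded_shift A (fun k => u k y)). now apply Hb.
      + lra.
      + exists (Rmin d d'). split; [now apply Rmin_glb_lt|]. intros y Dy Hy.
        apply Rmin_Rgt in Hy. destruct Hy as [Y1 Y2].
        specialize (Hd y Dy Y1). specialize (Hd' y Dy Y2).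
        rewrite (CSeries_split A _ (Hb y Dy)), (CSeries_split A _ (Hb x Dx)).
        match goal with |- (Cmod (?p + ?q - (?r + ?s)) < _)%R =>
          replace (p + q - (r + s)) with ((p - r) + (q - s)) by ring end.
        eapply Rle_lt_trans; [apply Cmod_triangle|].
        replace (4 * A * (1 / 2) ^ S N)%R with (4 * (A / 2) * (1 / 2) ^ N)%R by (simpl; field).
        lra. }
  intros eps He.
  destruct (pow_lt_1_zero (1 / 2) ltac:(rewrite Rabs_right; lra) (eps / 2 / (4 * A + 1))%R)
    as [N HN].
  { apply Rdiv_lt_0_compat; lra. }
  specialize (HN N (le_n N)).
  rewrite Rabs_right in HN by (apply Rle_ge, pow_le; lra).
  apply Rlt_div_r in HN; [|lra].
  pose proof (pow_le (1 / 2) N ltac:(lra)) as P.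
  destruct (L N u A Hc Hb (eps / 2)%R ltac:(lra)) as [d [d0 Hd]].
  exists d. split; [exact d0|]. intros y Dy Hy. specialize (Hd y Dy Hy). nra.
Qed.

(** Termwise differentiation.  The slopes of the terms at a point obey the bound on
    the derivatives, by the mean value inequality, so their series is continuous
    there and is a slope of the sum. *)
Lemma is_deriv_on_CSeries a b (U u : nat -> R -> C) A :
  (forall k, is_deriv_on (seg a b) (U k) (u k)) ->
  (forall k, cont_on (seg a b) (u k)) ->
  (forall x, seg a b x -> geom_bounded A (fun k => U k x)) ->
  (forall x, seg a b x -> geom_bounded A (fun k => u k x)) ->
  is_deriv_on (seg a b) (fun x => CSeries (fun k => U k x)) (fun x => CSeries (fun k => u k x)).
Proof.
  intros HU Hc BU Bu. apply is_deriv_on_iff. intros x Dx.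
  (* the difference quotients of the terms at [x], with the derivative as value at [x] *)
  set (phi := fun k y => if Req_EM_T y x then u k x else (U k y - U k x) / (y - x)%R).
  assert (Pne : forall y, y <> x -> RtoC (y - x)%R <> 0).
  { intros y E E0. apply RtoC_inj in E0. lra. }
  assert (Px : forall k, phi k x = u k x).
  { intros k. unfold phi. destruct (Req_EM_T x x); [reflexivity|contradiction]. }
  assert (Pf : forall k y, U k y = U k x + (y - x)%R * phi k y).
  { intros k y. unfold phi. destruct (Req_EM_T y x) as [->|E].
    - replace (x - x)%R with 0%R by ring. ring.
    - field. now apply Pne. }
  assert (Pc : forall k, cts_at (seg a b) (phi k) x).
  { intros k. destruct (proj1 (is_deriv_on_iff _ _ _) (HU k) x Dx) as [psi [Sc [Sx Sf]]].
    apply cts_at_ext with (f := psi); [exact Dx| |exact Sc].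
    intros y Dy. unfold phi. destruct (Req_EM_T y x) as [->|E]; [exact Sx|].
    rewrite (Sf y Dy). field. now apply Pne. }
  assert (Pb : forall y, seg a b y -> geom_bounded A (fun k => phi k y)).
  { intros y Dy k. unfold phi. destruct (Req_EM_T y x) as [->|E]; [now apply Bu|].
    rewrite Cmod_div by now apply Pne. rewrite Cmod_R.
    apply Rle_div_l; [apply Rabs_pos_lt; lra|]. rewrite Rmult_comm.
    apply (Cmod_deriv_le a b (U k) (u k)); auto. intros t Dt. now apply Bu. }
  exists (fun y => CSeries (fun k => phi k y)). split; [|split].
  - now apply (cts_at_CSeries _ _ A).
  - apply CSeries_ext; [exact Px|]. now apply (Csummable_geom A), Pb.
  - intros y Dy. apply is_Cseries_CSeries.
    apply is_Cseries_ext with (u := fun k => U k x + (y - x)%R * phi k y).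
    + intros k. symmetry. apply Pf.
    + apply is_Cseries_plus; [now apply (CSeries_geom A), BU|].
      apply is_Cseries_scal. now apply (CSeries_geom A), Pb.
Qed.

(** * Formal powers and their generating series *)

(** [fe] at even indices, [fo] at odd ones. *)
Definition alternate (fe fo : R -> C) (n : nat) : R -> C := if Nat.even n then fe else fo.

(** The term of index [n - 2], zero for [n < 2]. *)
Definition lag2 (Y : nat -> R -> C) (n : nat) : R -> C :=
  match n with S (S k) => Y k | _ => fun _ => 0 end.

(** The integrand producing [Y (n + 1)]: [ae Y(n) + be Y(n-2)] for [n] even and
    [ao Y(n) + bo Y(n-2)] for [n] odd. *)
Definition step (ae be ao bo : R -> C) (Y : nat -> R -> C) (n : nat) (y : R) : C :=
  alternate ae ao n y * Y n y + alternate be bo n y * lag2 Y n y.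

(** Systems of formal powers at [x0].  Both [X_tilde] and [X_plain] are of this
    form; they differ by an exchange of the coefficients of even and odd steps. *)
Definition formal_powers (ae be ao bo : R -> C) (x0 : R) (Y : nat -> R -> C) : Prop :=
  (forall x, Y O x = 1) /\
  forall n x, Y (S n) x = CInt (step ae be ao bo Y n) x0 x.

Lemma CInt_ext (f g : R -> C) s t : (forall x, f x = g x) -> CInt f s t = CInt g s t.
Proof. intros E. apply (RInt_ext (V := C_R_CompleteNormedModule)). auto. Qed.

Lemma X_tilde_formal_powers Q dQ v0 x0 :
  formal_powers (fun y => v0 y ^ 2 * (dQ y / Q y ^ 2)) (fun y => v0 y ^ 2 / Q y)
    (fun y => Q y / v0 y ^ 2) (fun _ => 0) x0 (X_tilde Q dQ v0 x0).
Proof.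
  split; [reflexivity|]. intros n x.
  cbn [X_tilde]. rewrite Nat.odd_succ. unfold step, alternate.
  destruct (Nat.even n).
  - apply CInt_ext. intros y.
    destruct n as [|[|k]]; simpl lag2; ring.
  - apply CInt_ext. intros y.
    ring.
Qed.

Lemma X_plain_formal_powers Q dQ v0 x0 :
  formal_powers (fun y => Q y / v0 y ^ 2) (fun _ => 0)
    (fun y => v0 y ^ 2 * (dQ y / Q y ^ 2)) (fun y => v0 y ^ 2 / Q y) x0 (X_plain Q dQ v0 x0).
Proof.
  split; [reflexivity|]. intros n x.
  cbn [X_plain]. rewrite Nat.odd_succ. unfold step, alternate.
  destruct (Nat.even n).
  - apply CInt_ext. intros y.
    ring.
  - apply CInt_ext. intros y.
    destruct n as [|[|k]]; simpl lag2; ring.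
Qed.

(** Induction along the dependence of [Y (n + 1)] on [Y n] and [Y (n - 2)]. *)
Lemma strong_ind_lag2 (P : nat -> Prop) : P O ->
  (forall n, P n -> (forall k, n = S (S k) -> P k) -> P (S n)) -> forall n, P n.
Proof.
  intros P0 PS n. induction n as [n IH] using (well_founded_induction Nat.lt_wf_0).
  destruct n as [|n]; [exact P0|]. apply PS; [apply IH; lia|]. intros k ->. apply IH; lia.
Qed.

Lemma formal_powers_cont a b ae be ao bo x0 Y :
  cont_on (seg a b) ae -> cont_on (seg a b) be ->
  cont_on (seg a b) ao -> cont_on (seg a b) bo -> seg a b x0 ->
  formal_powers ae be ao bo x0 Y ->
  forall n, cont_on (seg a b) (Y n) /\ cont_on (seg a b) (step ae be ao bo Y n).
Proof.
  intros Cae Cbe Cao Cbo H0 [Y0 YS].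
  assert (St : forall n, cont_on (seg a b) (Y n) ->
     (forall k, n = S (S k) -> cont_on (seg a b) (Y k)) ->
     cont_on (seg a b) (step ae be ao bo Y n)).
  { intros n Hn Hk. unfold step. apply cont_on_plus; apply cont_on_mult; auto.
    - unfold alternate. now destruct (Nat.even n).
    - unfold alternate. now destruct (Nat.even n).
    - destruct n as [|[|k]]; simpl; auto using cont_on_const. }
  assert (L : forall n, cont_on (seg a b) (Y n)).
  { intros n. induction n as [|n IH IHk] using strong_ind_lag2.
    - apply is_deriv_on_cont with (df := fun _ => 0).
      apply is_deriv_on_ext with (f := fun _ => 1) (df := fun _ => 0); auto using is_deriv_on_const.
    - apply is_deriv_on_cont with (df := step ae be ao bo Y n).
      apply is_deriv_on_ext with (f := fun x => CInt (step ae be ao bo Y n) x0 x)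
        (df := step ae be ao bo Y n); auto using is_deriv_on_CInt. }
  auto.
Qed.

Lemma formal_powers_deriv a b ae be ao bo x0 Y :
  cont_on (seg a b) ae -> cont_on (seg a b) be ->
  cont_on (seg a b) ao -> cont_on (seg a b) bo -> seg a b x0 ->
  formal_powers ae be ao bo x0 Y ->
  forall n, is_deriv_on (seg a b) (Y (S n)) (step ae be ao bo Y n).
Proof.
  intros Cae Cbe Cao Cbo H0 HY n.
  destruct (formal_powers_cont a b ae be ao bo x0 Y Cae Cbe Cao Cbo H0 HY n) as [_ Hs].
  apply is_deriv_on_ext with (f := fun x => CInt (step ae be ao bo Y n) x0 x)
    (df := step ae be ao bo Y n); auto using is_deriv_on_CInt.
  intros x _. symmetry. apply HY.
Qed.

Lemma alternate_bounded a b fe fo : (a <= b)%R ->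
  cont_on (seg a b) fe -> cont_on (seg a b) fo ->
  exists M : R, forall n x, seg a b x -> (Cmod (alternate fe fo n x) <= M)%R.
Proof.
  intros Hab He Ho.
  destruct (cont_on_bounded a b fe Hab He) as [M HM].
  destruct (cont_on_bounded a b fo Hab Ho) as [N HN].
  exists (Rmax M N). intros n x Hx. unfold alternate. destruct (Nat.even n).
  - eapply Rle_trans; [now apply HM|apply Rmax_l].
  - eapply Rle_trans; [now apply HN|apply Rmax_r].
Qed.

(** The formal powers decay faster than any geometric sequence, uniformly on the
    segment, and so do their derivatives. *)
Lemma formal_powers_bound a b ae be ao bo x0 Y (eps : R) :
  cont_on (seg a b) ae -> cont_on (seg a b) be ->
  cont_on (seg a b) ao -> cont_on (seg a b) bo -> seg a b x0 ->
  formal_powers ae be ao bo x0 Y -> (0 < eps)%R ->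
  exists E : R, forall n x, seg a b x ->
    (Cmod (Y n x) <= E * eps ^ n)%R /\ (Cmod (step ae be ao bo Y n x) <= E * eps ^ S n)%R.
Proof.
  intros Cae Cbe Cao Cbo H0 HY He.
  assert (Hab : (a <= b)%R) by (unfold seg in H0; lra).
  destruct (alternate_bounded a b ae ao Hab Cae Cao) as [M1 HM1].
  destruct (alternate_bounded a b be bo Hab Cbe Cbo) as [M2 HM2].
  set (M := (Rmax 1 (Rmax M1 M2))).
  assert (M0 : (1 <= M)%R) by apply Rmax_l.
  assert (A1 : (M1 <= M)%R) by (eapply Rle_trans; [apply Rmax_l|apply Rmax_r]).
  assert (A2 : (M2 <= M)%R) by (eapply Rle_trans; [apply Rmax_r|apply Rmax_r]).
  (* [K] makes one integration absorb exactly one factor [eps] *)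
  set (K := (M * (/ eps + / eps ^ 3))%R).
  assert (Ie : (0 < / eps)%R) by now apply Rinv_0_lt_compat.
  assert (Ie3 : (0 < / eps ^ 3)%R) by (apply Rinv_0_lt_compat, pow_lt; lra).
  assert (K0 : (0 < K)%R) by (apply Rmult_lt_0_compat; lra).
  set (e := fun x => exp (K * Rabs (x - x0))).
  assert (e0 : forall x, (0 < e x)%R) by (intros; apply exp_pos).
  assert (St : forall n x, seg a b x -> (Cmod (Y n x) <= eps ^ n * e x)%R ->
     (forall k, n = S (S k) -> (Cmod (Y k x) <= eps ^ k * e x)%R) ->
     (Cmod (step ae be ao bo Y n x) <= K * eps ^ S n * e x)%R).
  { intros n x Hx Hn Hk. unfold step.
    assert (Hl : (Cmod (lag2 Y n x) <= eps ^ n * / eps ^ 2 * e x)%R).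
    { assert (T : (0 <= eps ^ n * / eps ^ 2 * e x)%R).
      { repeat apply Rmult_le_pos; [apply pow_le; lra| |apply Rlt_le, e0].
        apply Rlt_le, Rinv_0_lt_compat, pow_lt; lra. }
      destruct n as [|[|k]]; simpl lag2; try (rewrite Cmod_0; exact T).
      replace (eps ^ S (S k) * / eps ^ 2 * e x)%R with (eps ^ k * e x)%R
        by (simpl; field; lra).
      now apply Hk. }
    eapply Rle_trans; [apply Cmod_triangle|]. rewrite !Cmod_mult.
    replace (K * eps ^ S n * e x)%R with
      (M * (eps ^ n * e x) + M * (eps ^ n * / eps ^ 2 * e x))%R
      by (unfold K; simpl; field; lra).
    specialize (HM1 n x Hx). specialize (HM2 n x Hx).
    apply Rplus_le_compat; apply Rmult_le_compat; try apply Cmod_ge_0; lra. }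
  assert (B : forall n x, seg a b x -> (Cmod (Y n x) <= eps ^ n * e x)%R).
  { intros n. induction n as [|n IH IHk] using strong_ind_lag2; intros x Hx.
    - rewrite (proj1 HY), Cmod_1. simpl. rewrite Rmult_1_l. unfold e. rewrite <- exp_0 at 1.
      destruct (Rle_lt_or_eq_dec 0 (K * Rabs (x - x0))) as [T|T].
      + apply Rmult_le_pos; [lra|apply Rabs_pos].
      + now apply Rlt_le, exp_increasing.
      + rewrite <- T. apply Rle_refl.
    - rewrite (proj2 HY).
      replace (eps ^ S n * e x)%R with ((K * eps ^ S n) / K * e x)%R by (field; lra).
      apply (Cmod_CInt_exp_le a b); [|exact K0| |exact H0|exact Hx|].
      + now apply (formal_powers_cont a b ae be ao bo x0 Y).
      + apply Rmult_le_pos; [lra|apply pow_le; lra].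
      + intros t Ht. apply St; auto. }
  set (E := exp (K * (b - a))).
  assert (eE : forall x, seg a b x -> (e x <= E)%R).
  { intros x Hx. unfold e, E.
    assert (T : (K * Rabs (x - x0) <= K * (b - a))%R).
    { apply Rmult_le_compat_l; [lra|]. unfold seg in *. apply Rabs_le. lra. }
    destruct T as [T|T]; [now apply Rlt_le, exp_increasing|rewrite T; apply Rle_refl]. }
  assert (E0 : (0 < E)%R) by apply exp_pos.
  exists ((1 + K) * E)%R. intros n x Hx. specialize (eE x Hx). specialize (e0 x).
  assert (p : forall m, (0 < eps ^ m)%R) by (intros; now apply pow_lt).
  split.
  - eapply Rle_trans; [now apply B|]. specialize (p n).
    apply Rle_trans with (eps ^ n * E)%R; [nra|].
    assert (0 <= K * E * eps ^ n)%R by (repeat apply Rmult_le_pos; lra). nra.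
  - eapply Rle_trans; [apply St; auto|]. specialize (p (S n)).
    apply Rle_trans with (K * eps ^ S n * E)%R.
    + apply Rmult_le_compat_l; [apply Rmult_le_pos; lra|exact eE].
    + nra.
Qed.

(** The generating series in [lam] of the terms of even index. *)
Definition even_series (lam : C) (Y : nat -> R -> C) (x : R) : C :=
  CSeries (fun k => lam ^ k * Y (2 * k)%nat x).

(** The same for the terms of odd index, that of index [2k + 1] carrying [lam^k]. *)
Definition odd_series (lam : C) (Y : nat -> R -> C) (x : R) : C :=
  CSeries (fun k => lam ^ k * Y (2 * k + 1)%nat x).

(** A ratio [eps] for which [|lam| eps^2 <= 1/2], so that decay at rate [eps] makes
    the generating series geometrically dominated. *)
Lemma geom_bounded_subseq (lam : C) : exists eps : R, (0 < eps <= 1)%R /\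
  forall (E : R) (i : nat) (Z : nat -> C), (0 <= E)%R ->
   (forall k, (Cmod (Z k) <= E * eps ^ (2 * k + i))%R) ->
   geom_bounded E (fun k => lam ^ k * Z k).
Proof.
  pose proof (Cmod_ge_0 lam) as L0.
  exists (/ (2 + Cmod lam))%R.
  assert (P : (0 < 2 + Cmod lam)%R) by lra.
  set (eps := (/ (2 + Cmod lam))%R).
  assert (e0 : (0 < eps)%R) by now apply Rinv_0_lt_compat.
  assert (e1 : (eps <= 1 / 2)%R).
  { unfold eps. replace (1 / 2)%R with (/ 2)%R by field. apply Rinv_le_contravar; lra. }
  assert (el : (Cmod lam * eps <= 1)%R).
  { unfold eps. apply Rle_div_l; lra. }
  split; [lra|].
  intros E i Z E0 HZ k. rewrite Cmod_mult, Cmod_pow.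
  assert (T1 : (Cmod lam ^ k * eps ^ (2 * k) <= (1 / 2) ^ k)%R).
  { rewrite pow_mult, <- Rpow_mult_distr. apply pow_incr. split.
    - apply Rmult_le_pos; [lra|]. apply pow_le; lra.
    - simpl. rewrite Rmult_1_r, <- Rmult_assoc.
      apply Rle_trans with (1 * eps)%R; [|lra]. apply Rmult_le_compat_r; lra. }
  assert (T2 : (0 < eps ^ i <= 1)%R).
  { split; [now apply pow_lt|]. rewrite <- (pow1 i). apply pow_incr. lra. }
  assert (C0 : (0 <= Cmod lam ^ k)%R) by now apply pow_le.
  apply Rle_trans with (Cmod lam ^ k * (E * eps ^ (2 * k + i)))%R.
  - apply Rmult_le_compat_l; auto.
  - rewrite pow_add.
    assert (0 <= Cmod lam ^ k * eps ^ (2 * k))%R.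
    { apply Rmult_le_pos; [exact C0|apply pow_le; lra]. }
    replace (Cmod lam ^ k * (E * (eps ^ (2 * k) * eps ^ i)))%R with
      (E * ((Cmod lam ^ k * eps ^ (2 * k)) * eps ^ i))%R by ring.
    apply Rmult_le_compat_l; [exact E0|]. nra.
Qed.

(** Termwise differentiation gives [lam^k Y(2k)' = lam^k (ao Y(2k-1) + bo Y(2k-3))]
    and [lam^k Y(2k+1)' = lam^k (ae Y(2k) + be Y(2k-2))]; each fall of the index by
    [2] contributes a factor [lam] to the sum. *)
Lemma formal_powers_series a b ae be ao bo x0 Y lam :
  cont_on (seg a b) ae -> cont_on (seg a b) be ->
  cont_on (seg a b) ao -> cont_on (seg a b) bo -> seg a b x0 ->
  formal_powers ae be ao bo x0 Y ->
  (forall x, seg a b x -> Csummable (fun k => lam ^ k * Y (2 * k)%nat x)) /\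
  (forall x, seg a b x -> Csummable (fun k => lam ^ k * Y (2 * k + 1)%nat x)) /\
  is_deriv_on (seg a b) (even_series lam Y)
    (fun x => lam * (ao x + lam * bo x) * odd_series lam Y x) /\
  is_deriv_on (seg a b) (odd_series lam Y)
    (fun x => (ae x + lam * be x) * even_series lam Y x).
Proof.
  intros Cae Cbe Cao Cbo H0 HY.
  destruct (geom_bounded_subseq lam) as [eps [He G]].
  destruct (formal_powers_bound a b ae be ao bo x0 Y eps Cae Cbe Cao Cbo H0 HY (proj1 He))
    as [E HE].
  assert (E0 : (0 <= E)%R).
  { destruct (HE O x0 H0) as [T _]. simpl in T. pose proof (Cmod_ge_0 (Y O x0)). lra. }
  pose proof (formal_powers_cont a b ae be ao bo x0 Y Cae Cbe Cao Cbo H0 HY) as YC.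
  pose proof (formal_powers_deriv a b ae be ao bo x0 Y Cae Cbe Cao Cbo H0 HY) as YD.
  assert (Be : forall x, seg a b x -> geom_bounded E (fun k => lam ^ k * Y (2 * k)%nat x)).
  { intros x Hx. apply (G E 0%nat); [exact E0|]. intros k. rewrite Nat.add_0_r. now apply HE. }
  assert (Bo : forall x, seg a b x -> geom_bounded E (fun k => lam ^ k * Y (2 * k + 1)%nat x)).
  { intros x Hx. apply (G E 1%nat); [exact E0|]. intros k. now apply HE. }
  (* the derivative of [Y n], which vanishes for [n = 0] *)
  set (dY := fun n => match n return R -> C with
                      | O => fun _ => RtoC 0
                      | S m => step ae be ao bo Y m
                      end).
  assert (DY : forall n, is_deriv_on (seg a b) (Y n) (dY n)).
  { intros [|n]; [|apply YD].
    apply is_deriv_on_ext with (f := fun _ => 1) (df := fun _ => 0); auto using is_deriv_on_const.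
    intros x _. symmetry. apply HY. }
  assert (CY : forall n, cont_on (seg a b) (dY n)).
  { intros [|n]; [apply cont_on_const|apply YC]. }
  assert (BY : forall n x, seg a b x -> (Cmod (dY n x) <= E * eps ^ n)%R).
  { intros [|n] x Hx; [|now apply HE]. simpl. rewrite Cmod_0. lra. }
  assert (Se : forall x, seg a b x ->
    is_Cseries (fun k => lam ^ k * Y (2 * k)%nat x) (even_series lam Y x)).
  { intros x Hx. now apply (CSeries_geom E), Be. }
  assert (So : forall x, seg a b x ->
    is_Cseries (fun k => lam ^ k * Y (2 * k + 1)%nat x) (odd_series lam Y x)).
  { intros x Hx. now apply (CSeries_geom E), Bo. }
  assert (Ev : forall k, Nat.even (2 * k) = true).
  { intros k. rewrite Nat.even_mul. reflexivity. }
  assert (Od : forall k, Nat.even (2 * k + 1) = false).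
  { intros k. rewrite Nat.add_1_r, Nat.even_succ, <- Nat.negb_even, Ev. reflexivity. }
  split; [|split; [|split]].
  - intros x Hx. now apply (Csummable_geom E), Be.
  - intros x Hx. now apply (Csummable_geom E), Bo.
  - apply is_deriv_on_ext with (f := even_series lam Y)
      (df := fun x => CSeries (fun k => lam ^ k * dY (2 * k)%nat x)).
    + reflexivity.
    + intros x Hx. apply is_Cseries_CSeries.
      replace (lam * (ao x + lam * bo x) * odd_series lam Y x)
        with (lam ^ 0 * dY (2 * 0)%nat x + (lam * (ao x * odd_series lam Y x)
           + lam * (bo x * (0 + lam * odd_series lam Y x)))) by (simpl; ring).
      apply is_Cseries_shift.
      apply is_Cseries_ext with (u := fun k => lam * (ao x * (lam ^ k * Y (2 * k + 1)%nat x))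
        + lam * (bo x * (lam ^ k * lag2 Y (2 * k + 1)%nat x))).
      * intros k. replace (2 * S k)%nat with (S (2 * k + 1)) by lia.
        cbn [dY]. unfold step, alternate. rewrite Od. cbn [Cpow]. ring.
      * apply is_Cseries_plus; apply is_Cseries_scal, is_Cseries_scal; [now apply So|].
        replace (RtoC 0) with (lam ^ 0 * lag2 Y (2 * 0 + 1)%nat x) by (simpl; ring).
        apply (is_Cseries_shift (fun k => lam ^ k * lag2 Y (2 * k + 1)%nat x)).
        apply is_Cseries_ext with (u := fun k => lam * (lam ^ k * Y (2 * k + 1)%nat x)).
        -- intros k. replace (2 * S k + 1)%nat with (S (S (2 * k + 1))) by lia.
           cbn [lag2 Cpow]. ring.
        -- apply is_Cseries_scal. now apply So.
    + apply (is_deriv_on_CSeries a b _ _ E).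
      * intros k. now apply is_deriv_on_scal.
      * intros k. apply cont_on_mult; [apply cont_on_const|apply CY].
      * exact Be.
      * intros x Hx. apply (G E 0%nat); [exact E0|]. intros k. rewrite Nat.add_0_r. now apply BY.
  - apply is_deriv_on_ext with (f := odd_series lam Y)
      (df := fun x => CSeries (fun k => lam ^ k * dY (2 * k + 1)%nat x)).
    + reflexivity.
    + intros x Hx. apply is_Cseries_CSeries.
      replace ((ae x + lam * be x) * even_series lam Y x)
        with (ae x * even_series lam Y x
           + be x * (0 + lam * even_series lam Y x)) by ring.
      apply is_Cseries_ext with (u := fun k => ae x * (lam ^ k * Y (2 * k)%nat x)
        + be x * (lam ^ k * lag2 Y (2 * k)%nat x)).
      * intros k. rewrite Nat.add_1_r.
        cbn [dY]. unfold step, alternate. rewrite Ev. ring.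
      * apply is_Cseries_plus; apply is_Cseries_scal; [now apply Se|].
        replace (RtoC 0) with (lam ^ 0 * lag2 Y (2 * 0)%nat x) by (simpl; ring).
        apply (is_Cseries_shift (fun k => lam ^ k * lag2 Y (2 * k)%nat x)).
        apply is_Cseries_ext with (u := fun k => lam * (lam ^ k * Y (2 * k)%nat x)).
        -- intros k. replace (2 * S k)%nat with (S (S (2 * k))) by lia.
           cbn [lag2 Cpow]. ring.
        -- apply is_Cseries_scal. now apply Se.
    + apply (is_deriv_on_CSeries a b _ _ E).
      * intros k. now apply is_deriv_on_scal.
      * intros k. apply cont_on_mult; [apply cont_on_const|apply CY].
      * exact Bo.
      * intros x Hx. apply (G E 1%nat); [exact E0|]. intros k. now apply BY.
Qed.

Lemma formal_powers_series_x0 ae be ao bo x0 Y lam :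
  formal_powers ae be ao bo x0 Y ->
  even_series lam Y x0 = 1 /\ odd_series lam Y x0 = 0.
Proof.
  intros [Y0 YS].
  assert (YZ : forall n, Y (S n) x0 = 0).
  { intros n. rewrite YS. apply (RInt_point (V := C_R_CompleteNormedModule)). }
  assert (Z : is_Cseries (fun _ => 0) 0).
  { pose proof (CSeries_geom 0 (fun _ => 0)) as T.
    assert (B : geom_bounded 0 (fun _ => 0)) by (intros k; rewrite Cmod_0; lra).
    specialize (T B). pose proof (Cmod_CSeries_le 0 _ B) as L.
    rewrite Rmult_0_r in L.
    rewrite (Cmod_eq_0 (CSeries (fun _ => 0))) in T; [exact T|].
    apply Rle_antisym; [exact L|apply Cmod_ge_0]. }
  split; apply is_Cseries_CSeries.
  - replace (RtoC 1) with (lam ^ 0 * Y (2 * 0)%nat x0 + 0) by (simpl; rewrite Y0; ring).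
    apply (is_Cseries_shift (fun k => lam ^ k * Y (2 * k)%nat x0)).
    apply is_Cseries_ext with (u := fun _ => 0); [|exact Z].
    intros k. replace (2 * S k)%nat with (S (2 * k + 1)) by lia. rewrite YZ. ring.
  - apply is_Cseries_ext with (u := fun _ => 0); [|exact Z].
    intros k. rewrite Nat.add_1_r, YZ. ring.
Qed.

(** * The first-order linear system *)

(** [(g, h)] solves [g' = r h], [h' = s g]. *)
Definition linear_pair (D : R -> Prop) (r s g h : R -> C) : Prop :=
  is_deriv_on D g (fun x => r x * h x) /\ is_deriv_on D h (fun x => s x * g x).

Lemma linear_pair_combine D r s g1 h1 g2 h2 c1 c2 :
  linear_pair D r s g1 h1 -> linear_pair D r s g2 h2 ->
  linear_pair D r s (fun x => c1 * g1 x + c2 * g2 x) (fun x => c1 * h1 x + c2 * h2 x).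
Proof.
  intros [G1 H1] [G2 H2]. split.
  - apply is_deriv_on_ext with (f := fun x => c1 * g1 x + c2 * g2 x)
      (df := fun x => c1 * (r x * h1 x) + c2 * (r x * h2 x)); [reflexivity|intros; ring|].
    now apply is_deriv_on_plus; apply is_deriv_on_scal.
  - apply is_deriv_on_ext with (f := fun x => c1 * h1 x + c2 * h2 x)
      (df := fun x => c1 * (s x * g1 x) + c2 * (s x * g2 x)); [reflexivity|intros; ring|].
    now apply is_deriv_on_plus; apply is_deriv_on_scal.
Qed.

Lemma linear_pair_wronskian a b r s g1 h1 g2 h2 x y :
  linear_pair (seg a b) r s g1 h1 -> linear_pair (seg a b) r s g2 h2 ->
  seg a b x -> seg a b y -> g1 x * h2 x - g2 x * h1 x = g1 y * h2 y - g2 y * h1 y.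
Proof.
  intros [G1 H1] [G2 H2].
  apply (is_deriv_on_zero_const a b (fun t => g1 t * h2 t - g2 t * h1 t)).
  apply is_deriv_on_ext with (f := fun t => g1 t * h2 t + - (1) * (g2 t * h1 t))
    (df := fun t => (r t * h1 t * h2 t + g1 t * (s t * g2 t))
       + - (1) * (r t * h2 t * h1 t + g2 t * (s t * g1 t))); [intros; ring|intros; ring|].
  apply is_deriv_on_plus; [|apply is_deriv_on_scal].
  - now apply (is_deriv_on_mult _ g1 h2 (fun t => r t * h1 t) (fun t => s t * g2 t)).
  - now apply (is_deriv_on_mult _ g2 h1 (fun t => r t * h2 t) (fun t => s t * g1 t)).
Qed.

(** Cramer's rule with the constant Wronskians [W(g1, g2) = 1], [W(g, g2) = g x0] and
    [W(g1, g) = h x0]. *)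
Lemma linear_pair_general a b r s g1 h1 g2 h2 x0 g h : seg a b x0 ->
  linear_pair (seg a b) r s g1 h1 -> linear_pair (seg a b) r s g2 h2 ->
  g1 x0 = 1 -> h1 x0 = 0 -> g2 x0 = 0 -> h2 x0 = 1 ->
  linear_pair (seg a b) r s g h ->
  forall x, seg a b x ->
    g x = g x0 * g1 x + h x0 * g2 x /\ h x = g x0 * h1 x + h x0 * h2 x.
Proof.
  intros S0 L1 L2 E1 E2 E3 E4 L x Sx.
  pose proof (linear_pair_wronskian a b r s _ _ _ _ x x0 L1 L2 Sx S0) as W.
  pose proof (linear_pair_wronskian a b r s _ _ _ _ x x0 L L2 Sx S0) as W1.
  pose proof (linear_pair_wronskian a b r s _ _ _ _ x x0 L1 L Sx S0) as W2.
  rewrite E1, E2, E3, E4 in W. rewrite E3, E4 in W1. rewrite E1, E2 in W2.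
  replace (1 * 1 - 0 * 0) with (RtoC 1) in W by ring.
  replace (g x0 * 1 - 0 * h x0) with (g x0) in W1 by ring.
  replace (1 * h x0 - g x0 * 0) with (h x0) in W2 by ring.
  rewrite <- W1, <- W2. split.
  - transitivity (g x * 1); [ring|]. rewrite <- W. ring.
  - transitivity (h x * 1); [ring|]. rewrite <- W. ring.
Qed.

(** The change of unknowns.  In [v1'] the terms [(v0' / Q) g'] and [- h v0' / v0^2],
    up to sign, cancel because [g' = (Q / v0^2) h], and [(v0' / Q)' g = - P v2]; what
    remains of the first equation is the equation for [h']. *)
Lemma system_iff_linear_pair (D : R -> Prop) (P Q dQ : R -> C) (lam : C)
  (v0 dv0 dw0 v1 v2 g h : R -> C) :
  (forall x, D x -> Q x <> 0) -> is_deriv_on D Q dQ ->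
  (forall x, D x -> v0 x <> 0) -> is_deriv_on D v0 dv0 ->
  is_deriv_on D (fun x => dv0 x / Q x) dw0 ->
  (forall x, D x -> dw0 x + P x * v0 x = 0) ->
  (forall x, D x -> v1 x = - ((dv0 x + lam * v0 x) / Q x * g x + h x / v0 x)) ->
  (forall x, D x -> v2 x = v0 x * g x) ->
  system_solution D P Q lam v1 v2 <->
  linear_pair D (fun x => Q x / v0 x ^ 2)
    (fun x => lam * (v0 x ^ 2 * (dQ x / Q x ^ 2) + lam * (v0 x ^ 2 / Q x))) g h.
Proof.
  intros HQ DQ H0 D0 Dw Heq E1 E2.
  assert (Edw : forall x, D x -> dw0 x = - (P x * v0 x)).
  { intros x Dx. specialize (Heq x Dx).
    transitivity (dw0 x + P x * v0 x - P x * v0 x); [ring|rewrite Heq; ring]. }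
  pose proof (is_deriv_on_inv D Q dQ HQ DQ) as DiQ.
  pose proof (is_deriv_on_inv D v0 dv0 H0 D0) as Di0.
  (* derivative of the coefficient (v0' + lam v0) / Q *)
  assert (Dc : is_deriv_on D (fun x => (dv0 x + lam * v0 x) / Q x)
    (fun x => dw0 x + lam * (dv0 x * / Q x + v0 x * (- dQ x / (Q x * Q x))))).
  { apply is_deriv_on_ext with (f := fun x => dv0 x / Q x + lam * (v0 x * / Q x))
      (df := fun x => dw0 x + lam * (dv0 x * / Q x + v0 x * (- dQ x / (Q x * Q x)))).
    - intros x Dx. field. auto.
    - reflexivity.
    - apply is_deriv_on_plus; [exact Dw|]. apply is_deriv_on_scal. now apply is_deriv_on_mult. }
  split.
  - intros [S1 S2].
    assert (G : is_deriv_on D g (fun x => Q x / v0 x ^ 2 * h x)).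
    { pose proof (is_deriv_on_mult D _ _ _ _ Di0 S2) as T.
      revert T. apply is_deriv_on_ext.
      - intros x Dx. rewrite (E2 x Dx). field. auto.
      - intros x Dx. rewrite (E2 x Dx), (E1 x Dx). simpl. field. auto. }
    split; [exact G|].
    pose proof (is_deriv_on_plus D _ _ _ _ S1 (is_deriv_on_mult D _ _ _ _ Dc G)) as T.
    pose proof (is_deriv_on_mult D _ _ _ _ (is_deriv_on_scal D (- (1)) _ _ D0) T) as T'.
    revert T'. apply is_deriv_on_ext.
    + intros x Dx. rewrite (E1 x Dx). field. auto.
    + intros x Dx. rewrite (E2 x Dx), (E1 x Dx), (Edw x Dx). simpl. field. auto.
  - intros [G H]. split.
    + pose proof (is_deriv_on_scal D (- (1)) _ _ (is_deriv_on_plus D _ _ _ _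
        (is_deriv_on_mult D _ _ _ _ Dc G) (is_deriv_on_mult D _ _ _ _ H Di0))) as T.
      revert T. apply is_deriv_on_ext.
      * intros x Dx. rewrite (E1 x Dx). field. auto.
      * intros x Dx. rewrite (E2 x Dx), (E1 x Dx), (Edw x Dx). simpl. field. auto.
    + pose proof (is_deriv_on_mult D _ _ _ _ D0 G) as T.
      revert T. apply is_deriv_on_ext.
      * intros x Dx. now rewrite (E2 x Dx).
      * intros x Dx. rewrite (E2 x Dx), (E1 x Dx). simpl. field. auto.
Qed.

Theorem theorem4p2 (a b : R) (hab : (a < b)%R)
  (P Q dQ : R -> C) (lam : C)
  (hQ0 : forall x, seg a b x -> Q x <> 0)
  (hdQ : is_deriv_on (seg a b) Q dQ)
  (v0 dv0 dw0 : R -> C)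
  (hv0_ne : forall x, seg a b x -> v0 x <> 0)
  (hdv0 : is_deriv_on (seg a b) v0 dv0)
  (hdv0_cont : cont_on (seg a b) dv0)
  (hdw0 : is_deriv_on (seg a b) (fun x => dv0 x / Q x) dw0)
  (hdw0_cont : cont_on (seg a b) dw0)
  (heq : forall x, seg a b x -> dw0 x + P x * v0 x = 0)
  (hc1 : cont_on (seg a b) (fun x => v0 x ^ 2 * (dQ x / Q x ^ 2)))
  (hc2 : cont_on (seg a b) (fun x => v0 x ^ 2 / Q x))
  (hc3 : cont_on (seg a b) (fun x => Q x / v0 x ^ 2))
  (x0 : R) (hx0 : seg a b x0) :
  (forall x, seg a b x ->
     Csummable (fun k => lam ^ k * X_tilde Q dQ v0 x0 (2 * k)%nat x) /\
     Csummable (fun k => lam ^ k * X_tilde Q dQ v0 x0 (2 * k + 1)%nat x) /\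
     Csummable (fun k => lam ^ k * X_plain Q dQ v0 x0 (2 * k)%nat x) /\
     Csummable (fun k => lam ^ k * X_plain Q dQ v0 x0 (2 * k + 1)%nat x)) /\
  (forall v1 v2 : R -> C,
     system_solution (seg a b) P Q lam v1 v2 <->
     exists c1 c2 : C, forall x, seg a b x ->
       v1 x = gen_v1 Q dQ v0 dv0 x0 lam c1 c2 x /\
       v2 x = gen_v2 Q dQ v0 x0 lam c1 c2 x) /\
  (forall c1 c2 : C,
     (forall x, seg a b x ->
        c1 * gen_v1 Q dQ v0 dv0 x0 lam 1 0 x
        + c2 * gen_v1 Q dQ v0 dv0 x0 lam 0 1 x = 0 /\
        c1 * gen_v2 Q dQ v0 x0 lam 1 0 x
        + c2 * gen_v2 Q dQ v0 x0 lam 0 1 x = 0) ->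
     c1 = 0 /\ c2 = 0).
Proof.
  set (r := fun x => Q x / v0 x ^ 2).
  set (s := fun x => lam * (v0 x ^ 2 * (dQ x / Q x ^ 2) + lam * (v0 x ^ 2 / Q x))).
  set (g1 := even_series lam (X_tilde Q dQ v0 x0)).
  set (h1 := fun x => lam * odd_series lam (X_tilde Q dQ v0 x0) x).
  set (g2 := odd_series lam (X_plain Q dQ v0 x0)).
  set (h2 := even_series lam (X_plain Q dQ v0 x0)).
  assert (c0 : cont_on (seg a b) (fun _ => 0)) by apply cont_on_const.
  destruct (formal_powers_series a b _ _ _ _ x0 _ lam hc1 hc2 hc3 c0 hx0
    (X_tilde_formal_powers Q dQ v0 x0)) as (Te & To & Tg & Th).
  destruct (formal_powers_series a b _ _ _ _ x0 _ lam hc3 c0 hc1 hc2 hx0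
    (X_plain_formal_powers Q dQ v0 x0)) as (Pe & Po & Ph & Pg).
  destruct (formal_powers_series_x0 _ _ _ _ x0 _ lam (X_tilde_formal_powers Q dQ v0 x0))
    as [Tg0 Th0].
  destruct (formal_powers_series_x0 _ _ _ _ x0 _ lam (X_plain_formal_powers Q dQ v0 x0))
    as [Ph0 Pg0].
  assert (L1 : linear_pair (seg a b) r s g1 h1).
  { split.
    - revert Tg. apply is_deriv_on_ext; [reflexivity|]. intros x _. unfold h1, r. ring.
    - apply (is_deriv_on_scal _ lam) in Th. revert Th.
      apply is_deriv_on_ext; [reflexivity|]. intros x _. unfold s, g1. ring. }
  assert (L2 : linear_pair (seg a b) r s g2 h2).
  { split.
    - revert Pg. apply is_deriv_on_ext; [reflexivity|]. intros x _. unfold h2, r. ring.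
    - revert Ph. apply is_deriv_on_ext; [reflexivity|]. intros x _. reflexivity. }
  assert (h1x0 : h1 x0 = 0) by (unfold h1; rewrite Th0; ring).
  assert (V1 : forall c1 c2 x, seg a b x -> gen_v1 Q dQ v0 dv0 x0 lam c1 c2 x =
     - ((dv0 x + lam * v0 x) / Q x * (c1 * g1 x + c2 * g2 x) + (c1 * h1 x + c2 * h2 x) / v0 x)).
  { intros c1 c2 x Sx. unfold gen_v1.
    fold (even_series lam (X_tilde Q dQ v0 x0) x). fold (odd_series lam (X_tilde Q dQ v0 x0) x).
    fold (even_series lam (X_plain Q dQ v0 x0) x). fold (odd_series lam (X_plain Q dQ v0 x0) x).
    unfold g1, g2, h1, h2. field. auto. }
  assert (V2 : forall c1 c2 x, gen_v2 Q dQ v0 x0 lam c1 c2 x = v0 x * (c1 * g1 x + c2 * g2 x)).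
  { intros c1 c2 x. unfold gen_v2.
    fold (even_series lam (X_tilde Q dQ v0 x0) x). fold (odd_series lam (X_plain Q dQ v0 x0) x).
    unfold g1, g2. ring. }
  split; [|split].
  - intros x Sx. auto.
  - intros v1 v2. split.
    + intros HS.
      set (g := fun x => v2 x / v0 x).
      set (h := fun x => - v0 x * (v1 x + (dv0 x + lam * v0 x) / Q x * g x)).
      assert (E1 : forall x, seg a b x ->
        v1 x = - ((dv0 x + lam * v0 x) / Q x * g x + h x / v0 x)).
      { intros x Sx. unfold h. field. auto. }
      assert (E2 : forall x, seg a b x -> v2 x = v0 x * g x).
      { intros x Sx. unfold g. field. auto. }
      apply (system_iff_linear_pair _ P Q dQ lam v0 dv0 dw0 v1 v2 g h) in HS; auto.
      pose proof (linear_pair_general a b r s g1 h1 g2 h2 x0 g h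
        hx0 L1 L2 Tg0 h1x0 Pg0 Ph0 HS) as GH.
      exists (g x0), (h x0). intros x Sx. destruct (GH x Sx) as [Gx Hx].
      rewrite V1, V2 by exact Sx. rewrite <- Gx, <- Hx. auto.
    + intros (c1 & c2 & HV).
      apply (system_iff_linear_pair _ P Q dQ lam v0 dv0 dw0 v1 v2
        (fun x => c1 * g1 x + c2 * g2 x) (fun x => c1 * h1 x + c2 * h2 x)); auto.
      * intros x Sx. rewrite <- V1 by exact Sx. now apply HV.
      * intros x Sx. rewrite <- V2. now apply HV.
      * exact (linear_pair_combine _ _ _ _ _ _ _ c1 c2 L1 L2).
  - intros c1 c2 HC. destruct (HC x0 hx0) as [C1 C2].
    rewrite !V1 in C1 by exact hx0. rewrite !V2 in C2.
    fold g1 in Tg0. fold g2 in Pg0. fold h2 in Ph0.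
    rewrite Tg0, Pg0, Ph0, h1x0 in C1. rewrite Tg0, Pg0 in C2.
    assert (Z1 : c1 = 0).
    { transitivity (/ v0 x0 * (c1 * (v0 x0 * (1 * 1 + 0 * 0)) + c2 * (v0 x0 * (0 * 1 + 1 * 0)))).
      - field. auto.
      - rewrite C2. ring. }
    split; [exact Z1|]. rewrite Z1 in C1.
    match type of C1 with ?t = _ => transitivity (- v0 x0 * t) end.
    + field. auto.
    + rewrite C1. ring.
Qed.
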